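(* Let $G$ be a finite cyclic group of order at least $5$ and let $H\neq\{e\}$ be a subgroup of $G$. Then the generalized non-coprime graph $\Gamma_{G,H}$ is chordal if and only if either $H$ is a $p$-group (for some prime $p$), or $H$ is not a $p$-group, $H=G$, and $|G|=p_1^{\alpha_1}p_2^{\alpha_2}p_3^{\alpha_3}$ for some distinct primes $p_1,p_2,p_3$ and non-negative integers $\alpha_1,\alpha_2,\alpha_3$.
   Context: For a finite group $G$ with identity $e$ and a subgroup $H\neq\{e\}$ of $G$, the generalized non-coprime graph $\Gamma_{G,H}$ is the simple undirected graph with vertex set $G\setminus\{e\}$ in which two distinct vertices $a,b$ are adjacent if and only if $\gcd(|a|,|b|)\neq 1$ and ($a\in H$ or $b\in H$), where $|a|$ denotes the order of the element $a$. A graph is chordal if every cycle of length four or more in it has a chord. *)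

(* Defs.v *)
From HB Require Import structures.
From mathcomp Require Import all_boot all_fingroup all_solvable.

Set Implicit Arguments.
Unset Strict Implicit.
Unset Printing Implicit Defensive.

Record sgraph := SGraph {
  vertex :> finType;
  adj : rel vertex;
  adj_sym : symmetric adj;
  adj_irrefl : irreflexive adj
}.

(* A chord joins two vertices of the cycle c that are not consecutive on c. *)
Definition is_chord (Gr : sgraph) (c : seq Gr) (x y : Gr) : bool :=
  [&& x \in c, y \in c, adj x y, y != next c x & x != next c y].

Definition chordal (Gr : sgraph) : Prop :=
  forall c : seq Gr, ucycle (@adj Gr) c -> 4 <= size c ->
    exists x y : Gr, is_chord c x y.

Definition gnc_vertex (gT : finGroupType) (G : {group gT}) : finType :=
  {x : gT | x \in G^#%g}.

Definition gnc_adj (gT : finGroupType) (G H : {group gT}) :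
    rel (gnc_vertex G) := fun a b =>
  [&& a != b, gcdn #[val a]%g #[val b]%g != 1
    & (val a \in H) || (val b \in H)].

Lemma gnc_adj_sym (gT : finGroupType) (G H : {group gT}) :
  symmetric (@gnc_adj gT G H).
Proof. by move=> a b; rewrite /gnc_adj eq_sym gcdnC orbC. Qed.

Lemma gnc_adj_irrefl (gT : finGroupType) (G H : {group gT}) :
  irreflexive (@gnc_adj gT G H).
Proof. by move=> a; rewrite /gnc_adj eqxx. Qed.

Definition gnc_graph (gT : finGroupType) (G H : {group gT}) : sgraph :=
  SGraph (@gnc_adj_sym gT G H) (@gnc_adj_irrefl gT G H).

Definition is_pgroup (gT : finGroupType) (H : {group gT}) : Prop :=
  exists2 p : nat, prime p & (p.-group H)%g.

(* Main.v *)
Require Import Defs.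
From HB Require Import structures.
From mathcomp Require Import all_boot all_fingroup all_solvable.

Set Implicit Arguments.
Unset Strict Implicit.
Unset Printing Implicit Defensive.

(** Every test for chordality reduces to cycles seen through [next]: on a cycle
of length at least four, a vertex and its second successor are never
consecutive, so an edge between them is a chord ([chord_of_skip]); and a
4-cycle without its two diagonals has no chord ([chordless4]).

If [H] is a [p]-group, every edge has an end of order a power of [p], so [p]
divides the order of every vertex of a cycle. A vertex of the cycle in [H] is
then adjacent to all the others, in particular to its second successor.

If [H] is not a [p]-group, distinct primes [p] and [q] divide its order.
When [H] is a proper subgroup, elements of [H] of orders [p] and [q] and two
mutually inverse generators of [G] form an induced 4-cycle: the generators
lie outside [H], hence are not adjacent. When [H] is [G], only the sets of
prime divisors of the orders matter. Four primes [p, q, r, s] give an induced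
4-cycle on elements of orders [pq, qr, rs, sp]. With at most three primes, a
cycle in which no vertex is adjacent to its second successor cannot exist:
each vertex shares a prime with both of its neighbours, whose orders are
coprime, so its order has at least two prime divisors; but then a vertex and
its second successor, having coprime orders, would require four primes
([size_primes_coprime]). *)

(** * Chords of cycles *)

(** Rotating the cycle so that it starts at [x] makes both successors explicit:
[x] is followed by three further distinct vertices. *)
Lemma next_next_neq (T : eqType) (c : seq T) (x : T) :
    uniq c -> 4 <= size c -> x \in c -> let y := next c (next c x) in
  [/\ x != y, y != next c x & x != next c y].
Proof.
move=> Uc c4 /rot_to[i s def_c].
have Us : uniq (x :: s) by rewrite -def_c rot_uniq.
have : 4 <= size (x :: s) by rewrite -def_c size_rot.
rewrite /= -!(next_rot i Uc) def_c.
case: s Us {def_c} => [|a [|b [|d s]]] //= + _.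
rewrite !inE !negb_or => /and3P[/and4P[xa xb xd _] /and3P[ab _ _] _].
rewrite !eqxx [a == x]eq_sym (negPf xa) eqxx.
by rewrite [b == x]eq_sym (negPf xb) [b == a]eq_sym (negPf ab).
Qed.

Lemma chord_of_skip (Gr : sgraph) (c : seq Gr) (x : Gr) :
    uniq c -> 4 <= size c -> x \in c -> adj x (next c (next c x)) ->
  is_chord c x (next c (next c x)).
Proof.
move=> Uc c4 cx xy; rewrite /is_chord cx !mem_next cx xy /=.
by have [_ -> ->] := next_next_neq Uc c4 cx.
Qed.

Lemma chordless4 (Gr : sgraph) (a b c d : Gr) :
    adj a b -> adj b c -> adj c d -> adj d a ->
    a != c /\ ~~ adj a c -> b != d /\ ~~ adj b d ->
  ~ chordal Gr.
Proof.
move=> ab bc cd da [eac nac] [ebd nbd] chG.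
have neq x y : adj x y -> x != y :> Gr.
  by apply: contraTneq => ->; rewrite adj_irrefl.
have [[[eab ebc] ecd] eda] := (neq _ _ ab, neq _ _ bc, neq _ _ cd, neq _ _ da).
have ead : a != d by rewrite eq_sym.
have [||x [y /and5P[]]] := chG [:: a; b; c; d] => //.
  by rewrite /ucycle /= ab bc cd da !inE !negb_or eab eac ead ebc ebd ecd.
have [nca ndb] : ~~ adj c a /\ ~~ adj d b by rewrite adj_sym nac adj_sym nbd.
rewrite !inE /=.
have sym u v : u != v -> ((u == v :> Gr) = false) * ((v == u) = false).
  by move=> /negPf uv; rewrite [v == u]eq_sym uv.
have E := (sym _ _ eab, sym _ _ eac, sym _ _ ead, sym _ _ ebc, sym _ _ ebd,
  sym _ _ ecd, eqxx).
by do 2![case/or4P=> /eqP->];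
  rewrite ?adj_irrefl ?(negPf nac, negPf nbd, negPf nca, negPf ndb) // !E.
Qed.

(** * Numbers with few prime divisors *)

Lemma not_coprimeP (m n : nat) :
  0 < m -> 0 < n ->
  reflect (exists2 p, p \in primes m & p \in primes n) (gcdn m n != 1).
Proof.
move=> m0 n0; rewrite -[gcdn m n == 1]/(coprime m n).
rewrite coprime_has_primes // negbK.
by apply: (iffP hasP) => -[p]; exists p.
Qed.

Lemma size_primes_ge2 (m p q : nat) :
  p != q -> p \in primes m -> q \in primes m -> 2 <= size (primes m).
Proof.
move=> pq mp mq; apply: (@uniq_leq_size _ [:: p; q]); first by rewrite /= inE pq.
by move=> r; rewrite !inE => /orP[] /eqP->.
Qed.

(** The prime that [m] shares with [a] differs from the one it shares with
[b]. *)
Lemma size_primes_between (a m b : nat) :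
    0 < a -> 0 < m -> 0 < b -> gcdn a b = 1 ->
    gcdn a m != 1 -> gcdn m b != 1 ->
  2 <= size (primes m).
Proof.
move=> a0 m0 b0 ab /not_coprimeP[] // p ap mp /not_coprimeP[] // q mq bq.
apply: size_primes_ge2 mp mq; apply/eqP=> pq; move/eqP: ab; apply/negP.
by apply/not_coprimeP=> //; exists p; rewrite // pq.
Qed.

Lemma size_primes_coprime (a b n : nat) :
    0 < n -> a %| n -> b %| n -> coprime a b ->
  size (primes a) + size (primes b) <= size (primes n).
Proof.
move=> n0 an bn; rewrite coprime_has_primes ?(dvdn_gt0 n0) // => nab.
rewrite -size_cat; apply: uniq_leq_size.
  by rewrite cat_uniq !primes_uniq andbT.
by move=> p; rewrite mem_cat !mem_primes n0 => /orP[]/and3P[-> _ /dvdn_trans->]; rewrite ?an ?bn.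
Qed.

Lemma prod_primes_superset (n : nat) (s : seq nat) :
    0 < n -> uniq s -> {subset primes n <= s} ->
  n = \prod_(p <- s) p ^ logn p n.
Proof.
move=> n0 Us sub; rewrite [LHS]prod_prime_decomp // prime_decompE big_map /=.
rewrite (perm_big [seq p <- s | p \in primes n]) /=; last first.
  apply: uniq_perm; rewrite ?primes_uniq ?filter_uniq // => p.
  by rewrite mem_filter andb_idr // => /sub.
rewrite big_filter big_mkcond; apply: eq_bigr => p _.
by case: ifP => //; rewrite -logn_gt0; case: (logn p n).
Qed.

(** Short lists of primes can be padded because there are infinitely many
primes. *)
Lemma extend_primes (s : seq nat) (k : nat) :
    uniq s -> all prime s -> size s <= k ->
  exists t, [/\ uniq t, all prime t, size t = k & {subset s <= t}].
Proof.
elim: k => [|k IH] Us Ps; first by rewrite leqn0 => /eqP s0; exists s; split=> //.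
rewrite leq_eqVlt => /orP[/eqP sz|/(IH Us Ps)[t [Ut Pt <- st]]].
  by exists s; split=> //.
have [p tp pP] := prime_above (\max_(q <- t) q).
exists (p :: t); split=> //=; last by move=> q /st tq; rewrite inE tq orbT.
  rewrite Ut andbT; apply: contraL tp => tp.
  by rewrite -leqNgt (leq_bigmax_seq p).
by rewrite pP.
Qed.

Lemma three_primes_form (n : nat) : 0 < n ->
  size (primes n) <= 3 <->
  exists p1 p2 p3 a1 a2 a3 : nat,
    [/\ prime p1, prime p2, prime p3,
        [/\ p1 != p2, p1 != p3 & p2 != p3] &
        n = p1 ^ a1 * p2 ^ a2 * p3 ^ a3].
Proof.
move=> n0; split=> [sz|].
  have Pn : all prime (primes n).
    by apply/allP=> p; rewrite mem_primes => /and3P[].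
  have [t [Ut Pt st sub]] := extend_primes (primes_uniq n) Pn sz.
  have:= prod_primes_superset n0 Ut sub.
  case: t st Ut Pt {sub} => [|p [|q [|r []]]] //= _.
  rewrite !inE negb_or => /and3P[/andP[pq pr] qr _] /and4P[Pp Pq Pr _].
  rewrite !big_cons big_nil muln1 mulnA => def_n.
  by exists p, q, r, (logn p n), (logn q n), (logn r n).
case=> p [q [r [a [b [c [Pp Pq Pr _ ->]]]]]].
apply: (@uniq_leq_size _ _ [:: p; q; r]); first exact: primes_uniq.
have pw x e s : prime x -> s \in primes (x ^ e) -> s = x.
  case: e => [|e] Px; first by rewrite expn0.
  by rewrite primesX // primes_prime // inE => /eqP.
move=> s; rewrite !primesM ?muln_gt0 ?expn_gt0 ?prime_gt0 // !inE.
by case/orP=> [/orP[]|] /pw->; rewrite ?eqxx ?orbT.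
Qed.

(** * Vertices of the generalized non-coprime graph *)

Section GncGraph.

Variables (gT : finGroupType) (G H : {group gT}).
Implicit Types v w : gnc_graph G H.

Lemma vertex_order_gt1 v : 1 < #[val v]%g.
Proof. by case: v => x /=; rewrite !inE order_gt1 => /andP[]. Qed.

Lemma vertex_of_mem (x : gT) :
  x \in G -> x != 1%g -> exists v, val v = x.
Proof.
move=> Gx x1; have xG : x \in G^#%g by rewrite !inE x1.
by exists (Sub x xG); rewrite SubK.
Qed.

Lemma vertex_of_order (n : nat) :
    cyclic G -> H \subset G -> n %| #|H| -> 1 < n ->
  exists2 v : gnc_graph G H, val v \in H & #[val v]%g = n.
Proof.
move=> cycG sHG nH n1; have /cyclicP[h defH] := cyclicS sHG cycG.
have ordn : #[h ^+ (#[h] %/ n)]%g = n.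
  have /dvdnP[k ok] : n %| #[h]%g by rewrite orderE -defH.
  have k0 : 0 < k by have:= order_gt0 h; rewrite ok muln_gt0 => /andP[].
  by rewrite ok mulnK ?(ltnW n1) // orderXdiv ok ?dvdn_mulr // mulKn.
have Hx : (h ^+ (#[h] %/ n))%g \in H by rewrite defH mem_cycle.
have [|v def_v] := vertex_of_mem (subsetP sHG _ Hx).
  by rewrite -order_gt1 ordn.
by exists v; rewrite def_v.
Qed.

Lemma adj_of_order v w :
    val v \in H -> #[val v]%g != #[val w]%g -> gcdn #[val v]%g #[val w]%g != 1 ->
  adj v w.
Proof.
move=> Hv vw gvw; rewrite /= /gnc_adj gvw Hv /= andbT.
by apply: contraNneq vw => ->.
Qed.

Lemma nadj_coprime v w :
  coprime #[val v]%g #[val w]%g -> v != w /\ ~~ adj v w.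
Proof.
move=> gvw; split; last by rewrite /= /gnc_adj [_ == 1]gvw andbF.
apply: contraTneq gvw => ->; rewrite /coprime gcdnn.
by rewrite neq_ltn vertex_order_gt1 orbT.
Qed.

(** * Sufficient conditions for chordality *)

(** The end of the edge lying in [H] has order a power of [p], so [p] is the only
prime the two orders can share. *)
Lemma adj_pgroup_dvdn (p : nat) v w :
  (p.-group H)%g -> adj v w -> p %| #[val v]%g /\ p %| #[val w]%g.
Proof.
move=> pH /and3P[_ /not_coprimeP[] // q]; rewrite !mem_primes.
case/and3P=> Pq _ qv /and3P[_ _ qw] /orP Hvw.
suff <- : q = p by [].
by apply/eqP; case: Hvw => Hx;
   apply: (pgroupP pH) => //; apply: dvdn_trans (order_dvdG Hx).
Qed.

(** Every edge meets [H], so the cycle has a vertex in [H]; all the orders on the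
cycle being multiples of [p], that vertex is adjacent to every other one. *)
Lemma chordal_pgroup : is_pgroup H -> chordal (gnc_graph G H).
Proof.
case=> p Pp pH c /andP[cyc_c Uc] c4.
have [x cx Hx] : exists2 x, x \in c & val x \in H.
  case: c cyc_c c4 {Uc} => [|u [|v s]] //= /andP[/and3P[_ _ /orP[]]] Hx _ _.
    by exists u; rewrite ?mem_head.
  by exists v; rewrite // !inE eqxx orbT.
set y := next c (next c x); exists x, y; apply: chord_of_skip => //.
have cy : y \in c by rewrite !mem_next.
have [px _] := adj_pgroup_dvdn pH (next_cycle cyc_c cx).
have [py _] := adj_pgroup_dvdn pH (next_cycle cyc_c cy).
rewrite /= /gnc_adj Hx andbT; apply/andP; split; last first.
  by apply/not_coprimeP=> //; exists p; rewrite mem_primes Pp order_gt0.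
by have [] := next_next_neq Uc c4 cx.
Qed.

(** If no vertex is adjacent to its second successor, the order of every vertex
of the form [next c v] lies between the coprime orders of its two neighbours,
sharing a prime with each, and so has two prime divisors. Applied to [next c x]
and to its second successor, this yields four primes dividing the order of
[G]. *)
Lemma chordal_three_primes :
  (H :=: G)%g -> size (primes #|G|) <= 3 -> chordal (gnc_graph G H).
Proof.
move=> eqHG G3 c /andP[cyc_c Uc] c4.
have [/existsP[x /andP[cx xy]] | /existsPn noskip] :=
    boolP [exists x : gnc_graph G H, (x \in c) && adj x (next c (next c x))].
  by exists x, (next c (next c x)); apply: chord_of_skip.
have inH v : val v \in H by rewrite eqHG; case: v => v /=; rewrite inE => /andP[].
have coprime_skip v : v \in c -> gcdn #[val v]%g #[val (next c (next c v))]%g = 1.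
  move=> cv; apply/eqP; apply: contraNT (noskip v) => gv; rewrite cv /=.
  by have [vv _ _] := next_next_neq Uc c4 cv; apply/and3P; split=> //; rewrite inH.
have share v : v \in c -> gcdn #[val v]%g #[val (next c v)]%g != 1.
  by move=> cv; have /and3P[] := next_cycle cyc_c cv.
have two v : v \in c -> 2 <= size (primes #[val (next c v)]%g).
  move=> cv; apply: size_primes_between (coprime_skip v cv) (share v cv) _ => //.
  by rewrite share ?mem_next.
have [x cx] : exists x, x \in c.
  by case: (c) c4 => // x s _; exists x; rewrite mem_head.
have ord_dvd v : #[val v]%g %| #|G| by have:= order_dvdG (inH v); rewrite [in #|H|]eqHG.
have cx1 : next c x \in c by rewrite mem_next.
have /eqP cop := coprime_skip _ cx1.
have:= size_primes_coprime (cardG_gt0 G) (ord_dvd _) (ord_dvd _) cop.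
move/leq_trans/(_ G3); rewrite leqNgt => /negP[].
by apply: (@leq_add 2 2); apply: two; rewrite ?mem_next.
Qed.

(** * Induced 4-cycles *)

Lemma pgroup_or_two_primes :
  (H :!=: 1)%g ->
  is_pgroup H \/ exists p q, [/\ p != q, p \in primes #|H| & q \in primes #|H|].
Proof.
rewrite -cardG_gt1 => H1; have Hp : pdiv #|H| \in primes #|H|.
  by rewrite mem_primes pdiv_prime ?cardG_gt0 ?pdiv_dvd.
have [pH | ] := boolP ((pdiv #|H|).-group H)%g.
  by left; exists (pdiv #|H|); rewrite ?pdiv_prime.
rewrite /pgroup /pnat cardG_gt0 /= => /allPn[q Hq qp].
by right; exists (pdiv #|H|), q; rewrite eq_sym.
Qed.

Lemma pgroup_primes_eq (p q : nat) :
  is_pgroup H -> p \in primes #|H| -> q \in primes #|H| -> p = q.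
Proof.
case=> r _ rH; suff E s : s \in primes #|H| -> s = r by move=> /E-> /E->.
by rewrite mem_primes => /and3P[Ps _ sH]; apply/eqP; apply: (pgroupP rH).
Qed.

(** Two mutually inverse generators of [G], which lie outside [H], close up the
elements of order [p] and [q] into an induced 4-cycle. *)
Lemma nchordal_proper (p q : nat) :
    cyclic G -> 2 < #|G| -> H \proper G ->
    p != q -> p \in primes #|H| -> q \in primes #|H| ->
  ~ chordal (gnc_graph G H).
Proof.
move=> cycG G3 ltHG pq; have sHG := proper_sub ltHG.
rewrite !mem_primes => /and3P[Pp _ pH] /and3P[Pq _ qH].
have [a Ha oa] := vertex_of_order cycG sHG pH (prime_gt1 Pp).
have [b Hb ob] := vertex_of_order cycG sHG qH (prime_gt1 Pq).
have /cyclicP[x defG] := cycG.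
have ox : #[x]%g = #|G| by rewrite defG.
have Gx : x \in G by rewrite defG cycle_id.
have [|v def_v] := vertex_of_mem Gx; first by rewrite -order_gt1 ox ltnW.
have [|w def_w] := vertex_of_mem (groupVr Gx).
  by rewrite -order_gt1 orderV ox ltnW.
have nHx : x \notin H.
  apply: contraL (proper_card ltHG) => Hx.
  by rewrite -leqNgt -ox dvdn_leq ?order_dvdG.
have ov : #[val v]%g = #|G| by rewrite def_v.
have ow : #[val w]%g = #|G| by rewrite def_w orderV.
have nvw : v != w.
  apply: contraTneq G3 => eq_vw; rewrite -leqNgt -ox dvdn_leq // order_dvdn.
  by rewrite expgS expg1 -{2}def_v eq_vw def_w mulgV.
have nHv : val v \notin H by rewrite def_v.
have nHw : val w \notin H by rewrite def_w groupV.
have adjG (y u : gnc_graph G H) r :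
    prime r -> r %| #|H| -> val y \in H -> #[val y]%g = r ->
    val u \notin H -> #[val u]%g = #|G| -> adj y u.
  move=> Pr rH Hy oy nHu ou; apply/and3P; split; last by rewrite Hy.
    by apply: contraNneq nHu => <-.
  rewrite oy ou; apply/not_coprimeP; rewrite ?cardG_gt0 ?prime_gt0 //; exists r.
    by rewrite primes_prime ?mem_head.
  by rewrite mem_primes Pr (dvdn_trans rH (cardSg sHG)) cardG_gt0.
apply: (@chordless4 _ a v b w).
- exact: adjG oa _ ov.
- by rewrite adj_sym; apply: adjG ob _ ov.
- exact: adjG ob _ ow.
- by rewrite adj_sym; apply: adjG oa _ ow.
- by apply: nadj_coprime; rewrite oa ob prime_coprime // dvdn_prime2.
- by split; rewrite //= /gnc_adj (negPf nHv) (negPf nHw) !andbF.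
Qed.

(** Arranging the primes [p, q, r, s] in a circle, elements whose orders are the
products of two neighbouring primes share a prime exactly when they are
neighbours themselves. *)
Lemma nchordal_four_primes :
    cyclic G -> (H :=: G)%g -> 3 < size (primes #|G|) ->
  ~ chordal (gnc_graph G H).
Proof.
move=> cycG eqHG; have sHG : H \subset G by rewrite eqHG.
have := primes_uniq #|G|; have: {subset primes #|G| <= primes #|G|} by [].
case: {1 3 4}(primes #|G|) => [|p [|q [|r [|s l]]]] // sub.
rewrite /= !inE !negb_or.
case/and5P=> /and4P[npq npr nps _] /and3P[nqr nqs _] /andP[nrs _] _ _ _.
have inP u : u \in [:: p; q; r; s] -> prime u /\ u %| #|H|.
  move=> su; have /sub: u \in [:: p, q, r, s & l].
    by rewrite -[[:: p, q, r, s & l]]/([:: p; q; r; s] ++ l) mem_cat su.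
  by rewrite mem_primes eqHG => /and3P[].
have [[Pp pH] [Pq qH] [Pr rH] [Ps sH]] :
    [/\ prime p /\ p %| #|H|, prime q /\ q %| #|H|, prime r /\ r %| #|H|
       & prime s /\ s %| #|H|].
  by split; apply: inP; rewrite !inE eqxx ?orbT.
have cop t u : prime t -> prime u -> t != u -> coprime t u.
  by move=> Pt Pu tu; rewrite prime_coprime // dvdn_prime2.
have vtx t u : prime t -> prime u -> t %| #|H| -> u %| #|H| -> t != u ->
    exists2 v : gnc_graph G H, val v \in H & #[val v]%g = t * u.
  move=> Pt Pu tH uH tu; apply: vertex_of_order => //.
    by rewrite Gauss_dvd ?tH ?cop.
  by rewrite (leq_trans (prime_gt1 Pt)) // leq_pmulr ?prime_gt0.
have [a Ha oa] := vtx p q Pp Pq pH qH npq.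
have [b Hb ob] := vtx q r Pq Pr qH rH nqr.
have [c Hc oc] := vtx r s Pr Ps rH sH nrs.
have [d Hd od] := vtx s p Ps Pp sH pH (etrans (congr1 negb (eq_sym s p)) nps).
have step v w t u x : val v \in H -> prime u -> t != x ->
    #[val v]%g = t * u -> #[val w]%g = u * x -> adj v w.
  move=> Hv Pu tx ov ow; apply: adj_of_order => //; rewrite ov ow.
    by rewrite mulnC eqn_pmul2l ?prime_gt0.
  by rewrite mulnC -muln_gcdr muln_eq1 negb_and neq_ltn prime_gt1 ?orbT.
apply: (@chordless4 _ a b c d).
- exact: step oa ob.
- exact: step ob oc.
- by apply: step oc od; rewrite // eq_sym.
- by apply: step od oa; rewrite // eq_sym.
- by apply: nadj_coprime; rewrite oa oc coprimeMl !coprimeMr !cop.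
- by apply: nadj_coprime; rewrite ob od coprimeMl !coprimeMr !cop // eq_sym.
Qed.
End GncGraph.

Theorem theorem2p12 (gT : finGroupType) (G H : {group gT})
    (cycG : cyclic G) (ordG : 5 <= #|G|)
    (sHG : H \subset G) (ntH : (H :!=: 1)%g) :
  chordal (gnc_graph G H) <->
  (is_pgroup H \/
   [/\ ~ is_pgroup H, (H :=: G)%g &
       exists p1 p2 p3 a1 a2 a3 : nat,
         [/\ prime p1, prime p2, prime p3,
             [/\ p1 != p2, p1 != p3 & p2 != p3] &
             #|G| = p1 ^ a1 * p2 ^ a2 * p3 ^ a3]]).
Proof.
have G3 := leq_trans (isT : 2 < 5) ordG.
split=> [chG | [|[_ eqHG] /three_primes_form]]; last 2 first.
- exact: chordal_pgroup.
- by move=> /(_ (cardG_gt0 G)); apply: chordal_three_primes.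
case: (pgroup_or_two_primes ntH) => [|[p [q [pq Hp Hq]]]]; [by left | right].
have npH : ~ is_pgroup H.
  by move=> pH; rewrite (pgroup_primes_eq pH Hp Hq) eqxx in pq.
have eqHG : (H :=: G)%g.
  apply/eqP; rewrite eqEproper sHG; apply/negP=> ltHG.
  exact: nchordal_proper cycG G3 ltHG pq Hp Hq chG.
split=> //; apply/three_primes_form; rewrite ?cardG_gt0 // leqNgt.
by apply/negP=> G4; apply: nchordal_four_primes cycG eqHG G4 chG.
Qed.
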